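(* Suppose $X$ is a disconnected, unbounded, locally compact, and isometrically homogeneous metric space. If $X$ is invertible, then there exist an integer $N\ge2$ and $s>1$ such that $X$ is bi-Lipschitz homeomorphic to $(C_N,\rho_s)$.
   Context: $X$ is isometrically homogeneous if its group of (surjective) self-isometries acts transitively on $X$. $(X,d)$ is invertible if it is unbounded and for some $p\in X$ there is a homeomorphism $\tau_p:X\setminus\{p\}\to X\setminus\{p\}$ with $d(\tau_p(x),\tau_p(y))=\dfrac{d(x,y)}{d(x,p)\,d(y,p)}$ for all $x,y\in X\setminus\{p\}$. A homeomorphism $f$ is bi-Lipschitz if for some $L\ge1$, $L^{-1}d(x,y)\le d(f(x),f(y))\le L\,d(x,y)$ for all $x,y$. For an integer $N\ge2$, $C_N$ is the set of sequences $\xi=(\xi_i)_{i\in\mathbb{Z}}$ with $\xi_i\in\{1,\dots,N\}$ for all $i$ and for which there is $m\in\mathbb{Z}$ with $\xi_i=1$ for all $i\le m$. For $s>1$, $\rho_s(\xi,\zeta)=s^{-m(\xi,\zeta)}$ where $m(\xi,\zeta)=\sup\{m\in\mathbb{Z}:\xi_i=\zeta_i\text{ for all }i\le m\}$ (so $\rho_s(\xi,\xi)=0$). (This is the parabolic visual boundary of the $(N+1)$-regular tree.) *)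

(* Defs.v *)
From HB Require Import structures.
From mathcomp Require Import all_boot all_order all_algebra.
From mathcomp Require Import all_classical all_reals all_analysis.

Set Implicit Arguments.
Unset Strict Implicit.
Unset Printing Implicit Defensive.

Import Order.TTheory GRing.Theory Num.Theory.

Local Open Scope classical_set_scope.
Local Open Scope ring_scope.

Definition homeomorphism (T U : topologicalType) (f : T -> U) : Prop :=
  continuous f /\
  exists g : U -> T, [/\ continuous g, cancel f g & cancel g f].

Definition isometry (R : realType) (X Y : metricType R) (f : X -> Y) : Prop :=
  forall x y : X, mdist (f x) (f y) = mdist x y.

Definition isometrically_homogeneous (R : realType) (X : metricType R) : Prop :=
  forall x y : X, exists f : X -> X,
    [/\ isometry f, (forall z : X, exists w : X, f w = z) & f x = y].

Definition unbounded (R : realType) (X : metricType R) : Prop :=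
  ~ exists M : R, forall x y : X, mdist x y <= M.

(* [set~ p] coerces to the subtype X \ {p}, with its subspace topology. *)
Definition invertible (R : realType) (X : metricType R) : Prop :=
  unbounded X /\
  exists p : X, exists tau : [set~ p] -> [set~ p],
    homeomorphism tau /\
    forall x y : [set~ p],
      mdist (set_val (tau x)) (set_val (tau y)) =
      mdist (set_val x) (set_val y) /
        (mdist (set_val x) p * mdist (set_val y) p).

Definition bilipschitz (R : realType) (X Y : metricType R) (f : X -> Y) : Prop :=
  exists L : R, 1 <= L /\
    forall x y : X,
      L^-1 * mdist x y <= mdist (f x) (f y) /\
      mdist (f x) (f y) <= L * mdist x y.

Definition bilipschitz_homeomorphic (R : realType) (X Y : metricType R) : Prop :=
  exists f : X -> Y, homeomorphism f /\ bilipschitz f.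

Definition boundary_seq (N : nat) : set (int -> nat) :=
  [set xi | (forall i : int, (1 <= xi i <= N)%N) /\
            exists m : int, forall i : int, i <= m -> xi i = 1%N].

Definition agree_upto (xi zeta : int -> nat) : set int :=
  [set m | forall i : int, i <= m -> xi i = zeta i].

(* The supremum is taken in the extended reals: it is +oo when xi = zeta. *)
Definition agreement (R : realType) (xi zeta : int -> nat) : \bar R :=
  ereal_sup [set (m%:~R)%:E | m in agree_upto xi zeta].

(* s^(-oo) = 0; the value -oo of agreement does not occur on boundary_seq N. *)
Definition rho (R : realType) (s : R) (xi zeta : int -> nat) : R :=
  if agreement R xi zeta is r%:E then s `^ (- r) else 0.

Section rho_metric.
Variables (R : realType) (N : nat) (s : R).
Hypothesis s1 : 1 < s.
Implicit Types xi zeta eta : int -> nat.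

Lemma agree_upto_down xi zeta (m n : int) :
  m <= n -> agree_upto xi zeta n -> agree_upto xi zeta m.
Proof. by move=> mn H i im; apply: H; apply: le_trans mn. Qed.

Lemma agree_upto_nonempty xi zeta : boundary_seq N xi -> boundary_seq N zeta ->
  agree_upto xi zeta !=set0.
Proof.
move=> [_ [m Hm]] [_ [n Hn]]; exists (Num.min m n) => i.
by rewrite le_min => /andP[im jn]; rewrite Hm// Hn.
Qed.

Lemma agreementC xi zeta : agreement R xi zeta = agreement R zeta xi.
Proof.
rewrite /agreement; congr (ereal_sup (_ @` _)).
by apply/seteqP; split=> m H i /H.
Qed.

Lemma agreementNy xi zeta : boundary_seq N xi -> boundary_seq N zeta ->
  agreement R xi zeta != -oo%E.
Proof.
move=> Hx Hz; have [m Hm] := agree_upto_nonempty Hx Hz.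
have : ((m%:~R : R)%:E <= agreement R xi zeta)%E.
  by apply: ereal_sup_ubound; exists m.
by apply: contraTneq => ->.
Qed.

Lemma agreement_refl xi : agreement R xi xi = +oo%E.
Proof.
have H (m : int) : ((m%:~R : R)%:E <= agreement R xi xi)%E.
  by apply: ereal_sup_ubound; exists m.
move: H; case: (agreement R xi xi) => [r| |] H //; last by have := H 0.
have := H (Num.floor r + 1)%R; rewrite lee_fin leNgt.
by rewrite floorD1_gt ?num_real.
Qed.

Lemma agreementy xi zeta : agreement R xi zeta = +oo%E -> xi = zeta.
Proof.
move=> H; apply/funext => i.
have : ((i%:~R : R)%:E < agreement R xi zeta)%E by rewrite H ltry.
case/ereal_sup_gt => _ [m Hm <-]; rewrite lte_fin ltr_int => /ltW; exact: Hm.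
Qed.

Lemma agreement_min xi zeta eta :
  (Order.min (agreement R xi zeta) (agreement R zeta eta)
     <= agreement R xi eta)%E.
Proof.
have [H|] := pselect (agree_upto xi zeta `<=` agree_upto zeta eta).
  rewrite ge_min; apply/orP; left; apply: ereal_sup_le; apply: image_subset.
  by move=> m Hm i im; rewrite Hm// (H _ Hm).
move=> /existsNP[n /not_implyP[nxz nze]].
rewrite ge_min; apply/orP; right; apply: ereal_sup_le; apply: image_subset.
move=> m Hm i im; rewrite -(Hm i im); apply: nxz; apply: le_trans im _.
rewrite leNgt; apply/negP => nm; apply: nze.
exact: agree_upto_down (ltW nm) Hm.
Qed.

Lemma rho_ge0 xi zeta : 0 <= rho s xi zeta.
Proof. by rewrite /rho; case: agreement => // r; exact: powR_ge0. Qed.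

Lemma rho_refl xi : rho s xi xi = 0.
Proof. by rewrite /rho agreement_refl. Qed.

Lemma rho_eq0 xi zeta : boundary_seq N xi -> boundary_seq N zeta ->
  rho s xi zeta = 0 -> xi = zeta.
Proof.
move=> Hx Hz; rewrite /rho; move: (agreementNy Hx Hz) (@agreementy xi zeta).
case: agreement => [r _ _ /eqP|_ H _|//]; last exact: H.
by rewrite gt_eqF// powR_gt0// (lt_trans ltr01).
Qed.

Lemma rhoC xi zeta : rho s xi zeta = rho s zeta xi.
Proof. by rewrite /rho agreementC. Qed.

Lemma rho_ultra xi zeta eta :
  boundary_seq N xi -> boundary_seq N zeta -> boundary_seq N eta ->
  rho s xi eta <= Num.max (rho s xi zeta) (rho s zeta eta).
Proof.
move=> Hx Hz He.
have anti a b : a != -oo%E -> (a <= b)%E ->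
  (if b is r%:E then s `^ (- r) else 0) <= (if a is r%:E then s `^ (- r) else 0).
  case: a b => [a| |] [b| |] //= _; rewrite ?powR_ge0// lee_fin => ab.
  by rewrite ler_powR ?lerN2// ltW.
have := agreement_min xi zeta eta.
rewrite ge_min le_max => /orP[] H; apply/orP; [left|right];
  by apply: anti H; exact: agreementNy.
Qed.

Lemma rho_triangle zeta xi eta :
  boundary_seq N xi -> boundary_seq N zeta -> boundary_seq N eta ->
  rho s xi eta <= rho s xi zeta + rho s zeta eta.
Proof.
move=> Hx Hz He; apply: le_trans (rho_ultra Hx Hz He) _.
by rewrite ge_max lerDl lerDr !rho_ge0.
Qed.

End rho_metric.

(* The metric space (C_N, rho_s). *)
Definition tree_boundary (R : realType) (N : nat) (s : R) (s1 : 1 < s) : Type :=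
  boundary_seq N.

Section tree_boundary_metric.
Variables (R : realType) (N : nat) (s : R) (s1 : 1 < s).
Local Notation C := (tree_boundary N s1).

HB.instance Definition _ := Choice.copy C (boundary_seq N : Type).

Definition boundary_dist (xi zeta : C) : R := rho s (set_val xi) (set_val zeta).

Lemma boundary_seqP (xi : C) : boundary_seq N (set_val xi).
Proof. exact: set_valP. Qed.

Lemma boundary_distxx xi : boundary_dist xi xi = 0.
Proof. exact: rho_refl. Qed.

Lemma boundary_dist_eq0 xi zeta : boundary_dist xi zeta = 0 -> xi = zeta.
Proof.
move=> /(rho_eq0 s1 (boundary_seqP xi) (boundary_seqP zeta)); exact: val_inj.
Qed.

Lemma boundary_distC xi zeta : boundary_dist xi zeta = boundary_dist zeta xi.
Proof. exact: rhoC. Qed.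

Lemma boundary_dist_triangle zeta xi eta :
  boundary_dist xi eta <= boundary_dist xi zeta + boundary_dist zeta eta.
Proof. by apply: (rho_triangle s1); exact: boundary_seqP. Qed.

HB.instance Definition _ := @isMetric.Build R C boundary_dist
  boundary_distxx boundary_dist_eq0 boundary_distC boundary_dist_triangle.

End tree_boundary_metric.

(* Main.v *)
Require Import Defs.
From mathcomp Require Import all_boot all_order all_algebra.
From mathcomp Require Import all_classical all_reals all_analysis.
From mathcomp Require Import ring lra zify.

(** The space has enough symmetry to be self-similar, and the failure of
    connectedness then propagates to all scales; a space which is uniformly
    disconnected, self-similar and homogeneous is the boundary of a regular tree.

    The inversion [T] at [p] exchanges [p] and infinity ([inversion_mdist]), which
    makes the space proper ([inversion_proper]). On the one-point compactification
    inversions and isometries generate a group of Moebius maps, and a suitable word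
    in them fixes infinity, that is, is a similarity of ratio [lam > 1]
    ([dilation_exists]). Composed with isometries, its powers send any point to
    any point at any ratio [lam ^ k].

    The key step is that there is a nonempty bounded clopen set
    ([bounded_clopen]). If not, the one-point compactification is connected but
    infinity is a cut point of it; by inversion and homogeneity so is every point,
    with pieces of a uniform size, and nested pieces of uniform size contradict
    compactness.

    A bounded clopen set is compact, hence separated from its complement by some
    [e > 0]: chains of steps shorter than [e] stay bounded, and by similarity
    chains of steps shorter than [e * lam ^ k] have diameter at most
    [M * lam ^ k]. The chain classes at the scales [lam ^ k] are therefore a nested
    family of partitions comparable with the balls. Each class splits into the same
    finite number [N >= 2] of classes of the next smaller scale, by similarity.
    Numbering these consistently ([labelling]), with the number 1 always given to
    the class of [p], the labels of a point at all scales form a sequence in [C_N];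
    this coding is onto by properness and bi-Lipschitz for [s = lam]
    ([coding_bilipschitz]). *)

Import Order.TTheory GRing.Theory Num.Theory.

Local Open Scope classical_set_scope.
Local Open Scope ring_scope.

(** * Sequences, similarities and local compactness *)

Section metric_prelim.
Set Implicit Arguments.
Unset Strict Implicit.
Context {R : realType} (X : metricType R).
Local Notation d := (@mdist R X).
Implicit Types (x y z p q : X) (u : nat -> X).

(** Sequential form of [cluster (u @ \oo) q]; all the compactness below is
    used through sequences. *)
Definition adherent u q := forall (e : R) (n : nat), 0 < e ->
  exists2 m, (n <= m)%N & d (u m) q < e.

(** Bolzano-Weierstrass, that is, closed balls are compact. *)
Definition proper_metric := forall u p (M : R),
  (forall n, d p (u n) <= M) -> exists q, adherent u q.

Definition similarity (c : R) (f : X -> X) :=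
  (forall x y, d (f x) (f y) = c * d x y) /\ (forall z, exists w, f w = z).

Lemma open_mdistP (S : set X) :
  open S <-> forall x, S x -> exists2 e : R, 0 < e & forall y, d x y < e -> S y.
Proof.
rewrite openE; split=> [oS x /oS|oS x /oS [e e0 H]].
  move=> /(metricType_numDomainType.nbhs_mdistP x S)[e e0 H].
  by exists e => // y /H.
by apply/(metricType_numDomainType.nbhs_mdistP x S); exists e => // y /H.
Qed.

(** Closed sets appear below as complements of open ones, so that all the
    topology goes through [open_mdistP]. *)
Lemma disconnected_clopen : ~ connected [set: X] ->
  exists A : set X, [/\ open A, open (~` A), A !=set0 & ~` A !=set0].
Proof.
move=> /existsNP[A /not_implyP[A0 /not_implyP[[C oC AC] /not_implyP[[D cD AD] AT]]]].
rewrite setTI in AC; rewrite setTI in AD; subst C.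
exists A; split => //; first by rewrite AD; exact: closed_openC.
by apply/set0P/eqP => h; apply: AT; rewrite -(setCK A) h setC0.
Qed.

Lemma unbounded_far : unbounded X -> forall p (M : R), exists x, M < d p x.
Proof.
move=> ub p M; apply: contrapT => /forallNP H; apply: ub; exists (M + M) => x y.
have {}H z : d p z <= M by rewrite leNgt; apply/negP/H.
by rewrite (le_trans (metric_triangle x p y))// lerD// metric_sym.
Qed.

Lemma homogeneous_similarity : isometrically_homogeneous X ->
  forall x y, exists2 f, similarity 1 f & f x = y.
Proof.
move=> hom x y; have [f [fi fs fxy]] := hom x y; exists f => //.
by split => // a b; rewrite mul1r fi.
Qed.

Lemma similarity_comp a b f g :
  similarity a f -> similarity b g -> similarity (a * b) (f \o g).
Proof.
move=> [fd fs] [gd gs]; split=> [x y|z] /=; first by rewrite fd gd mulrA.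
by have [w <-] := fs z; have [v <-] := gs w; exists v.
Qed.

Lemma similarity_inv c f : 0 < c -> similarity c f ->
  exists2 g, similarity c^-1 g & cancel g f.
Proof.
move=> c0 [fd fs]; have [g gK] := choice fs; exists g => //; split=> [x y|z].
  by rewrite -{2}(gK x) -{2}(gK y) fd mulKf// gt_eqF.
exists (f z); apply: (@mdist_positivity R X).
by apply/eqP; rewrite -(mulrI_eq0 _ (mulfI (lt0r_neq0 c0))) -fd gK mdistxx.
Qed.

Lemma similarity_exp c f k : 0 < c -> similarity c f ->
  exists g, similarity (c ^ k) g.
Proof.
move=> c0 fc; have [g gc _] := similarity_inv c0 fc.
have pow a h n : similarity a h -> exists g', similarity (a ^+ n) g'.
  move=> ah; elim: n => [|n [g' IH]].
    by exists id; split=> [x y|z]; [rewrite expr0 mul1r|exists z].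
  by exists (h \o g'); rewrite exprS; exact: similarity_comp.
case: k => n; first exact: (pow _ f _).
by have [h hc] := pow _ _ n.+1 gc; exists h; rewrite NegzE -exprnN -exprVn.
Qed.

Lemma compact_adherent (K : set X) u : compact K -> (forall n, K (u n)) ->
  exists q, adherent u q.
Proof.
move=> cK uK; have [|q [_ uq]] := cK (u @ \oo).
  by exists 0%N => // n _; exact: uK.
exists q => e n e0.
have [|//|y [[m nm <-] h]] := uq (u @` [set m | (n <= m)%N]) (ball q e).
- by exists n => // m nm; exists m.
- exact: nbhsx_ballx.
- by exists m => //; rewrite metric_sym; move: h; rewrite ballEmdist.
Qed.

(** Isometries carry one compact ball to all points, so that a single radius
    serves everywhere; in particular the space is complete. *)
Lemma homogeneous_uniform_compact : X -> locally_compact [set: X] ->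
  isometrically_homogeneous X ->
  exists2 r : R, 0 < r & forall p u, (forall n, d p (u n) < r) ->
    exists q, adherent u q.
Proof.
move=> x0 lc hom; have := lc x0 I; rewrite withinET => -[K nK [cK _]].
have [r r0 rK] := (metricType_numDomainType.nbhs_mdistP x0 K).1 nK.
exists r => // p u pu; have [f [fi fsur fp]] := hom p x0.
have [|q fq] := @compact_adherent K (f \o u) cK.
  by move=> n; apply: rK; rewrite /= -fp fi.
have [w fw] := fsur q; exists w => e n e0; have [m nm me] := fq e n e0.
by exists m => //; rewrite -fi fw.
Qed.

(** Bernoulli: [lam ^+ n] grows at least like [n * (lam - 1)]. *)
Lemma exp_exceeds (lam a b : R) : 1 < lam -> 0 < a ->
  exists n, b < a * lam ^+ n.
Proof.
move=> lam1 a0; pose c := (lam - 1) * a.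
have c0 : 0 < c by rewrite mulr_gt0// subr_gt0.
exists (Num.bound (`|b| / c)); apply: le_lt_trans (ler_norm b) _.
have : `|b| < c * (Num.bound (`|b| / c))%:R.
  rewrite mulrC -ltr_pdivrMr//.
  by apply: archi_boundP; rewrite divr_ge0// ltW.
move: (Num.bound _) => n bn; apply: lt_le_trans bn _.
rewrite /c mulrAC mulrC ler_pM2l//.
elim: n => [|n IH]; first by rewrite mulr0.
have l1 : 1 <= lam ^+ n by apply: exprn_ege1; exact: ltW.
rewrite exprS -natr1 mulrDr mulr1; nra.
Qed.

End metric_prelim.

(** * Inversions and properness *)

Section inversion.
Set Implicit Arguments.
Unset Strict Implicit.
Context {R : realType} (X : metricType R).
Local Notation d := (@mdist R X).
Implicit Types (x y z p q : X) (u : nat -> X) (T : X -> X).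

(** The inversion as a total self-map, constrained away from [p] only; its
    continuity there follows from the distance formula. *)
Definition inversion_at p T :=
  [/\ forall x, x != p -> T x != p,
      forall y, y != p -> exists2 x, x != p & T x = y
    & forall x y, x != p -> y != p -> d (T x) (T y) = d x y / (d x p * d y p)].

Lemma invertible_inversion : invertible X -> exists p T, inversion_at p T.
Proof.
move=> [_ [p [tau [[_ [g [_ tauK gK]]] taud]]]].
have inp x : x != p -> x \in [set~ p] by move=> /eqP xp; rewrite inE.
pose T x := match (x != p) =P true with
  | ReflectT h => set_val (tau (SigSub (inp x h))) | _ => p end.
have TE (x : [set~ p]) : T (set_val x) = set_val (tau x).
  rewrite /T; case: eqP => [h|].
    by congr (set_val (tau _)); exact: val_inj.
  by have /eqP -> := set_valP x.
have ex x : x != p -> exists y : [set~ p], set_val y = x.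
  by move=> xp; exists (SigSub (inp x xp)).
have np (x : [set~ p]) : set_val x != p by exact/eqP/(set_valP x).
exists p, T; split.
- by move=> _ /ex[x <-]; rewrite TE.
- by move=> _ /ex[y <-]; exists (set_val (g y)); rewrite ?np// TE gK.
- by move=> _ _ /ex[x <-] /ex[y <-]; rewrite !TE taud.
Qed.

Lemma mdist_mdistB x y z : `|d x z - d y z| <= d x y.
Proof.
have h1 := metric_triangle x y z; have h2 := metric_triangle y x z.
rewrite (metric_sym y x) in h2; rewrite ler_norml; lra.
Qed.

Hypothesis X_unbounded : unbounded X.
Variable r : R.
Hypothesis r_gt0 : 0 < r.
Hypothesis r_compact : forall p u, (forall n, d p (u n) < r) ->
  exists q, adherent u q.

(** If [u n] goes to infinity, the formula makes [T (u n)] a Cauchy sequence.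
    Its limit [q] satisfies [d (T y) q = (d y p)^-1] for all [y] other than [p], so
    [q] is not one of the points [T y]; as these are all the points but [p], this
    means [q = p]: the inversion exchanges [p] and infinity. *)
Lemma inversion_mdist p T x : inversion_at p T -> x != p -> d (T x) p = (d x p)^-1.
Proof.
move=> [Tp Ts Td] xp.
have /choice[u uD] (n : nat) := unbounded_far X_unbounded p n.+1%:R.
have up n : u n != p.
  by rewrite eq_sym -mdist_gt0 (lt_trans _ (uD n)).
have uD' n : n.+1%:R < d (u n) p by rewrite metric_sym.
have {uD} ui n : (d (u n) p)^-1 < n.+1%:R^-1.
  by rewrite ltf_pV2 ?posrE ?mdist_gt0 ?up.
have Tu n m : d (T (u n)) (T (u m)) <= (d (u n) p)^-1 + (d (u m) p)^-1.
  rewrite Td// -{1}(div1r (d (u n) p)) -(div1r (d (u m) p)).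
  rewrite addf_div ?gt_eqF ?mdist_gt0//.
  rewrite ler_pM2r ?invr_gt0 ?mulr_gt0 ?mdist_gt0// !mul1r.
  by rewrite addrC (le_trans (metric_triangle _ p _))// (metric_sym p).
have small (e : R) : 0 < e -> exists n, forall m, (n <= m)%N -> (d (u m) p)^-1 < e.
  move=> e0; have [n hn] := ltr_add_invr e0.
  exists n => m nm; rewrite add0r in hn.
  apply: lt_trans (ui m) _; apply: le_lt_trans hn.
  by rewrite lef_pV2 ?posrE// ler_nat ltnS.
have [n0 n0r] := small (r / 2) ltac:(by rewrite divr_gt0).
have [q qa] : exists q, adherent (fun n => T (u (n0 + n)%N)) q.
  apply: (@r_compact (T (u n0))) => n; apply: le_lt_trans (Tu _ _) _.
  by rewrite (splitr r) ltrD// n0r// leq_addr.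
have qe (e : R) : 0 < e -> exists n, [/\ d (T (u n)) q < e & (d (u n) p)^-1 < e].
  move=> e0; have [n1 n1e] := small e e0; have [m mn me] := qa e n1 e0.
  by exists (n0 + m)%N; split => //; apply: n1e; rewrite (leq_trans mn)// leq_addl.
(* passing to the limit in the formula for d (T (u n)) (T y) *)
have key y : y != p -> d (T y) q = (d y p)^-1.
  move=> yp; have yp0 : 0 < d y p by rewrite mdist_gt0.
  apply/eqP; rewrite -subr_eq0 -normr_le0; apply/ler_addgt0Pr => e e0; rewrite add0r.
  have [n [h1 h2]] := qe (e / 2) ltac:(by rewrite divr_gt0).
  have h3 : `|d (T (u n)) (T y) - (d y p)^-1| <= (d (u n) p)^-1.
    rewrite Td//; have un0 : 0 < d (u n) p by rewrite mdist_gt0.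
    have -> : d (u n) y / (d (u n) p * d y p) - (d y p)^-1 =
      (d y (u n) - d p (u n)) / (d (u n) p * d y p).
      by rewrite (metric_sym y (u n)) (metric_sym p (u n)); field; rewrite !gt_eqF.
    rewrite normrM [X in _ * X]gtr0_norm ?invr_gt0 ?mulr_gt0//.
    rewrite ler_pdivrMr ?mulr_gt0// mulrA mulVf ?gt_eqF// mul1r.
    exact: mdist_mdistB.
  have h4 := mdist_mdistB q (T (u n)) (T y).
  rewrite (metric_sym q (T y)) (metric_sym q) in h4.
  rewrite (splitr e) -(subrKA (d (T (u n)) (T y))).
  rewrite (le_trans (ler_normD _ _))// lerD// ltW//; lra.
suff qp : q = p by rewrite -{1}qp; exact: key.
apply/eqP; apply: contrapT => /negP qp; have [y yp yq] := Ts _ qp.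
by have := key y yp; rewrite yq mdistxx => /eqP; rewrite eq_sym invr_eq0 gt_eqF ?mdist_gt0.
Qed.

Hypothesis X_homogeneous : isometrically_homogeneous X.
Variables (o : X) (T : X -> X).
Hypothesis T_inversion : inversion_at o T.

(** Move a far point [q] to the centre [o] of the inversion: a bounded sequence
    then lies in an annulus around [o] of large inner radius, and [T] maps it into
    a small ball around [o], away from [o] itself. *)
Lemma inversion_proper : proper_metric X.
Proof.
move=> u p M uM; have [q qM] := unbounded_far X_unbounded p (M + r^-1).
have [s [sd ssur] sq] := homogeneous_similarity X_homogeneous q o.
have si x y : d (s x) (s y) = d x y by rewrite sd mul1r.
have [To Ts Td] := T_inversion.
have lo n : r^-1 < d (s (u n)) o.
  have := metric_triangle p (u n) q; have := uM n; rewrite -sq si; lra.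
have hi n : d (s (u n)) o <= M + d p q.
  by rewrite -sq si (le_trans (metric_triangle _ p _))// lerD2r metric_sym.
have ri0 : 0 < r^-1 by rewrite invr_gt0.
have su0 n : 0 < d (s (u n)) o by apply: lt_trans (lo n).
have suo n : s (u n) != o by rewrite -mdist_gt0.
have [y ya] : exists y, adherent (fun n => T (s (u n))) y.
  apply: (@r_compact o) => n; rewrite metric_sym inversion_mdist//.
  by rewrite -(invrK r) ltf_pV2 ?posrE.
have D0 : 0 < M + d p q by apply: lt_le_trans (hi 0%N).
have yo : y != o.
  apply/eqP => yo; subst y; have [|m _] := ya (M + d p q)^-1 0%N.
    by rewrite invr_gt0.
  by rewrite inversion_mdist// ltf_pV2 ?posrE// ltNge hi.
have [w wo Tw] := Ts y yo; have [v vw] := ssur w; have w0 : 0 < d w o by rewrite mdist_gt0.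
exists v => e n e0.
have [|m nm] := ya (e / ((M + d p q) * d w o)) n; first by rewrite divr_gt0// mulr_gt0.
rewrite -Tw Td// ltr_pdivlMr ?mulr_gt0// => h; exists m => //.
rewrite -si vw; apply: le_lt_trans h.
rewrite mulrAC ler_pdivlMr ?mulr_gt0//; apply: ler_wpM2l; first exact: mdist_ge0.
by rewrite ler_wpM2r ?mdist_ge0.
Qed.

End inversion.

(** * Moebius maps and the existence of a dilation *)

Section moebius.
Set Implicit Arguments.
Unset Strict Implicit.
Context {R : realType} (X : metricType R).
Local Notation d := (@mdist R X).
Implicit Types (x y z p q : X) (T : X -> X) (a b : option X).

(** The distance on the one-point compactification, [None] being infinity. It
    is not a metric, but it is the right normalisation: with it isometries and
    inversions, extended to infinity, become conformal in the same sense. *)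
Definition dinf a b : R :=
  match a, b with
  | Some x, Some y => d x y
  | None, None => 0
  | _, _ => 1
  end.

(** Preservation of cross-ratios, in the form of a conformal weight [w]. *)
Definition moebius (w : option X -> R) (f : option X -> option X) :=
  [/\ forall a, 0 < w a, forall a b, dinf (f a) (f b) = w a * w b * dinf a b
    & forall b, exists a, f a = b].

Lemma moebius_comp v w f g : moebius v f -> moebius w g ->
  moebius (fun a => w a * v (g a)) (f \o g).
Proof.
move=> [v0 fv fs] [w0 gw gs]; split=> [a|a b|c] /=.
- by rewrite mulr_gt0.
- by rewrite fv gw; ring.
- by have [b <-] := fs c; have [a <-] := gs b; exists a.
Qed.

Lemma moebius_isometry f : similarity 1 f -> moebius (fun=> 1) (omap f).
Proof.
move=> [fd fs]; split=> // [[x|] [y|]|[y|]] /=; rewrite ?mulr1 ?mulr0 //.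
- by have [x <-] := fs y; exists (Some x).
- by exists None.
Qed.

Definition extend_inversion p T a :=
  if a is Some x then if x == p then None else Some (T x) else Some p.

Definition inversion_weight p a : R :=
  if a is Some x then if x == p then 1 else (d x p)^-1 else 1.

Lemma moebius_inversion p T : inversion_at p T ->
  (forall x, x != p -> d (T x) p = (d x p)^-1) ->
  moebius (inversion_weight p) (extend_inversion p T).
Proof.
move=> [Tp Ts Td] Tr.
have pT x : x != p -> d p (T x) = (d x p)^-1 by rewrite metric_sym; exact: Tr.
split=> [[x|]|[x|] [y|]|[y|]] //=.
- by case: eqVneq => // xp; rewrite invr_gt0 mdist_gt0.
- case: (eqVneq x p) => [->|xp]; case: (eqVneq y p) => [->|yp] /=.
  + by rewrite mdistxx mulr0.
  + by rewrite mul1r (metric_sym p) mulVf// gt_eqF// mdist_gt0.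
  + by rewrite mulr1 mulVf// gt_eqF// mdist_gt0.
  + by rewrite Td// invfM mulrC.
- case: (eqVneq x p) => [_|xp] /=; first by rewrite !mulr1.
  by rewrite Tr// !mulr1.
- case: (eqVneq y p) => [_|yp] /=; first by rewrite !mulr1.
  by rewrite pT// mul1r !mulr1.
- by rewrite mulr0 mdistxx.
- have [->|yp] := eqVneq y p; first by exists None.
  by have [x xp <-] := Ts y yp; exists (Some x) => /=; rewrite (negbTE xp).
- by exists (Some p); rewrite /= eqxx.
Qed.

(** Comparing with the point at infinity shows that the weight is constant on the
    finite points, where the map is thus a similarity. *)
Lemma moebius_fix_infinity w f : moebius w f -> f None = None ->
  exists g : X -> X, similarity ((w None)^-1 ^+ 2) g.
Proof.
move=> [w0 fw fs] fN.
have fS x : exists y, f (Some x) = Some y.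
  case E : (f (Some x)) => [y|]; first by exists y.
  have := fw (Some x) None; rewrite E fN /= mulr1 => /esym/eqP.
  by rewrite gt_eqF// mulr_gt0.
have [g gE] := choice fS; exists g => //; split=> [x y|z].
  have wE z : w (Some z) = (w None)^-1.
    have := fw (Some z) None; rewrite fN gE /= mulr1 => h.
    by rewrite -[LHS](mulfK (lt0r_neq0 (w0 None))) -h mul1r.
  by have := fw (Some x) (Some y); rewrite !gE /= !wE expr2.
have [[x|] fx] := fs (Some z); last by rewrite fN in fx.
by exists x; have := gE x; rewrite fx => -[].
Qed.

(** Let [q] be at distance more than 1 from [p], let [s1] and [s2] be isometries
    with [s1 p = q] and [s2 (T q) = p]. The composite of [T], [s1], [T], [s2], [T]
    moves infinity along [p], [q], [T q], [p] and back to infinity; its weight at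
    infinity is [(d q p)^-1], so it is a similarity of ratio [d q p ^+ 2]. *)
Lemma dilation_exists p T : unbounded X -> isometrically_homogeneous X ->
  inversion_at p T -> (forall x, x != p -> d (T x) p = (d x p)^-1) ->
  exists2 c : R, 1 < c & exists f : X -> X, similarity c f.
Proof.
move=> ub hom Tinv Tr; have [q pq] := unbounded_far ub p 1.
have qp : q != p by rewrite eq_sym -mdist_gt0 (lt_trans _ pq).
have [s1 s1s s1p] := homogeneous_similarity hom p q.
have [s2 s2s s2p] := homogeneous_similarity hom (T q) p.
have mT := moebius_inversion Tinv Tr.
have mS1 := moebius_isometry s1s; have mS2 := moebius_isometry s2s.
have := moebius_fix_infinity (moebius_comp mT
  (moebius_comp mS2 (moebius_comp mT (moebius_comp mS1 mT)))).
rewrite /= s1p (negbTE qp) /= s2p eqxx => /(_ erefl)[g gs].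
exists (d q p ^+ 2); first by rewrite exprn_egt1// metric_sym.
by exists g; move: gs; rewrite !mul1r !mulr1 invrK.
Qed.

End moebius.

(** * Existence of a bounded clopen set *)

Section clopen.
Set Implicit Arguments.
Unset Strict Implicit.
Context {R : realType} (X : metricType R).
Local Notation d := (@mdist R X).
Implicit Types (x y z p q : X) (u : nat -> X) (T : X -> X) (A B : set X).

(** Removing [q] separates [B] from the rest of the space, and [B] is bounded:
    [q] is a cut point of the one-point compactification. The ball of radius [r]
    at [z] measures the size of [B] in a way that isometries preserve. *)
Definition cut (M r : R) q z B :=
  [/\ ~ B q, open B, open (~` (B `|` [set q])),
      forall x, B x -> d q x <= M & forall y, d z y < r -> B y].

Lemma cut_isometry M r q z B f : similarity 1 f -> cut M r (f q) (f z) B ->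
  cut M r q z (f @^-1` B).
Proof.
move=> [fd fs] [Bq oB oBC BM Bz]; have fi x y : d (f x) (f y) = d x y by rewrite fd mul1r.
split => //.
- apply/open_mdistP => x /= /((open_mdistP B).1 oB)[e e0 H]; exists e => // y xy.
  by apply: H; rewrite fi.
- apply/open_mdistP => x /= nx.
  have [|e e0 H] := (open_mdistP _).1 oBC (f x).
    move=> [Bfx|/= fxq]; apply: nx; first by left.
    by right; apply: (@mdist_positivity R X); rewrite -fi fxq mdistxx.
  exists e => // y xy [h|/= h]; apply: (H (f y)); rewrite ?fi//; first by left.
  by right; rewrite /= h.
- by move=> x /BM; rewrite fi.
- by move=> y zy; apply: Bz; rewrite fi.
Qed.

Hypothesis X_proper : proper_metric X.
Hypothesis X_homogeneous : isometrically_homogeneous X.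

Section no_bounded_clopen.
Hypothesis no_clopen : forall S p (M : R),
  open S -> open (~` S) -> (forall x, S x -> d p x <= M) -> forall x, ~ S x.

(** Otherwise [B `|` B'] or [B' `\` B] would be a nonempty bounded clopen set,
    according to whether [B'] contains [p] or not. *)
Lemma cut_nested M r p x B p' x' B' :
  cut M r p x B -> cut M r p' x' B' -> B p' -> B' `<=` B.
Proof.
move=> [Bp oB oBC BM _] [Bp' oB' oBC' BM' _] Bp'B.
have [B'p|B'p] := pselect (B' p).
  exfalso; apply: (@no_clopen (B `|` B') p (M + d p p' + M) _ _ _ p); last by right.
  - exact: openU.
  - have -> : ~` (B `|` B') = ~` (B `|` [set p]) `&` ~` (B' `|` [set p']).
      rewrite !setCU; apply/seteqP; split=> [y /= [h1 h2]|y /= [[h1 _] [h2 _]]] //.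
      by split; split => // E; subst y.
    exact: openI.
  - have M0 : 0 <= M by apply: le_trans (BM _ Bp'B); exact: mdist_ge0.
    have pp' := mdist_ge0 p p'.
    move=> y [/BM|/BM'] h; first lra.
    have := metric_triangle p p' y; lra.
move=> y B'y; apply: contrapT => By.
apply: (@no_clopen (B' `\` B) p' M _ _ _ y) => //.
- have -> : B' `\` B = B' `&` ~` (B `|` [set p]).
    apply/seteqP; split=> [w [B'w Bw]|w [B'w /not_orP[Bw _]]]; split => //.
    by apply/not_orP; split => // E; apply: B'p; rewrite -E.
  exact: openI.
- have -> : ~` (B' `\` B) = B `|` ~` (B' `|` [set p']).
    apply/seteqP; split=> [w /not_andP[B'w|/contrapT Bw]|w [Bw|/not_orP[B'w _]]].
    + have [Bw|Bw] := pselect (B w); [by left|right].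
      by apply/not_orP; split => // E; apply: Bw; rewrite E.
    + by left.
    + by move=> [_].
    + by move=> [].
  exact: openU.
- by move=> w [/BM'].

Qed.

(** Homogeneity gives a cut [f q] at every point [q]. Start anywhere and let the
    next point be the centre of the ball in the piece cut off by the current one.
    The pieces are nested, so each point has a ball of radius [r] that avoids all
    the previous points, though all of them stay in one bounded piece: this
    contradicts properness. *)
Lemma no_cut M r p x B : 0 < r -> ~ cut M r p x B.
Proof.
move=> r0 pB.
have /choice[f fcut] q : exists zB : X * set X, cut M r q zB.1 zB.2.
  have [s [sd ss] sq] := homogeneous_similarity X_homogeneous q p.
  have [z sz] := ss x; exists (z, s @^-1` B) => /=.
  by apply: (cut_isometry (conj sd ss)); rewrite sq sz.
pose u n := iter n (fun q => (f q).1) p.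
pose D n := (f (u n)).2.
have cD n : cut M r (u n) (u n.+1) (D n) by exact: fcut.
have ball_D n y : d (u n.+1) y < r -> D n y by have [_ _ _ _] := cD n; exact.
have uD n : D n (u n.+1) by apply: ball_D; rewrite mdistxx.
have DS n : D n.+1 `<=` D n by apply: cut_nested (cD n) (cD n.+1) (uD n).
have Dle m n : (m <= n)%N -> D n `<=` D m.
  move=> /subnK <-; elim: (n - m)%N => // k IH; rewrite addSn.
  exact: subset_trans (DS _) IH.
have sep m n : (m < n)%N -> r <= d (u n) (u m).
  case: n => // n mn; rewrite leNgt; apply/negP => /ball_D /(Dle m n mn).
  by have [] := cD m.
have [|q uq] := @X_proper u p M.
  have [_ _ _ D0 _] := cD 0%N.
  case=> [|n]; last by apply/D0/(Dle 0%N n)/uD.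
  by rewrite mdistxx (le_trans _ (D0 _ (uD 0%N)))// mdist_ge0.
have r2 : 0 < r / 2 by rewrite divr_gt0.
have [m _ hm] := uq _ 0%N r2; have [n mn hn] := uq _ m.+1 r2.
have := sep m n mn; have := metric_triangle (u n) q (u m).
rewrite (metric_sym q); lra.
Qed.

End no_bounded_clopen.

(** If all nonempty clopen sets are unbounded, the one-point compactification is
    connected, whereas the disconnection of the space makes infinity a cut point
    of it. The inversion [T] turns infinity into [p], so that [p] is a cut point
    too, and [no_cut] excludes this. It replaces the general fact that a continuum
    has non-cut points. *)
Lemma bounded_clopen p T A : inversion_at p T ->
  (forall x, x != p -> d (T x) p = (d x p)^-1) ->
  open A -> open (~` A) -> A !=set0 -> ~` A !=set0 ->
  exists S q (M : R), [/\ open S, open (~` S), S q & forall x, S x -> d q x <= M].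
Proof.
move=> [Tp Ts Td] Tr oA oAC [a Aa] [b Ab]; apply: contrapT => noS.
have {}noS S q (M : R) : open S -> open (~` S) ->
    (forall x, S x -> d q x <= M) -> forall x, ~ S x.
  move=> oS oSC SM x Sx; apply: noS; exists S, x, (d x q + M); split => // y Sy.
  by rewrite (le_trans (metric_triangle x q y))// lerD2l SM.
have [s [sd ss] sp] := homogeneous_similarity X_homogeneous p a.
have si x y : d (s x) (s y) = d x y by rewrite sd mul1r.
have Tcont x (e : R) : x != p -> 0 < e -> exists2 e', 0 < e' &
    forall y, d x y < e' -> y != p /\ d (T x) (T y) < e.
  move=> xp e0; have x0 : 0 < d x p by rewrite mdist_gt0.
  have x2 : 0 < d x p / 2 by rewrite divr_gt0.
  exists (Num.min (d x p / 2) (e * (d x p * (d x p / 2)))).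
    by rewrite lt_min x2 !mulr_gt0.
  move=> y; rewrite lt_min => /andP[h1 h2].
  have h3 : d x p / 2 < d y p by have := metric_triangle x y p; lra.
  have y0 : 0 < d y p by apply: lt_trans h3.
  have yp : y != p by rewrite -mdist_gt0.
  split => //; rewrite Td// ltr_pdivrMr ?mulr_gt0//; apply: lt_trans h2 _.
  by rewrite ltr_pM2l// ltr_pM2l.
have preim C x : open C -> x != p -> C (s (T x)) -> exists2 e : R, 0 < e &
    forall y, d x y < e -> y != p /\ C (s (T y)).
  move=> oC xp /((open_mdistP C).1 oC)[e e0 H].
  have [e' e'0 H'] := Tcont x e xp e0; exists e' => // y /H'[yp Txy].
  by split => //; apply: H; rewrite si.
pose B := [set x | x != p /\ (~` A) (s (T x))].
have oB : open B.
  apply/open_mdistP => x [xp Ax].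
  by have [e e0 H] := preim (~` A) x oAC xp Ax; exists e => // y /H.
have [x Bx] : B !=set0.
  have [w sw] := ss b; have wp : w != p.
    by apply/eqP => wp; apply: Ab; rewrite -sw wp sp.
  by have [x xp Tx] := Ts w wp; exists x; split => //; rewrite Tx sw.
have [r r0 xr] := (open_mdistP B).1 oB x Bx.
have [e e0 ae] := (open_mdistP A).1 oA a Aa.
suff : cut e^-1 r p x B by exact: no_cut.
split => //.
- by move=> [/eqP].
- apply/open_mdistP => y /not_orP[nBy /eqP yp].
  have [|e' e'0 H] := preim A y oA yp.
    by apply: contrapT => nA; apply: nBy.
  exists e' => // z /H[zp Az]; apply/not_orP; split; last exact/eqP.
  by move=> [_].
- move=> y [yp nAy]; rewrite metric_sym -[d y p]invrK -Tr// lef_pV2 ?posrE//.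
    by rewrite leNgt; apply/negP => h; apply/nAy/ae; rewrite -sp si metric_sym.
  by rewrite mdist_gt0 Tp.
Qed.

End clopen.

(** * Chains, scales and labels *)

Section chains.
Set Implicit Arguments.
Unset Strict Implicit.
Context {R : realType} (X : metricType R).
Local Notation d := (@mdist R X).
Implicit Types (x y z p q : X) (S : set X) (r c : R) (f : X -> X).

(** [x] and [y] are joined by finitely many steps shorter than [r]. In this
    impredicative form an induction along a chain is a choice of [S]. *)
Definition chain r x y := forall S, S x ->
  (forall u v, S u -> d u v < r -> S v) -> S y.

Lemma chain_refl r x : chain r x x. Proof. by move=> S Sx _. Qed.

Lemma chain_step r x y : d x y < r -> chain r x y.
Proof. by move=> xy S Sx h; exact: h xy. Qed.

Lemma chain_trans r y x z : chain r x y -> chain r y z -> chain r x z.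
Proof. by move=> xy yz S Sx Sr; apply: yz (Sr); apply: xy. Qed.

Lemma chain_sym r x y : chain r x y -> chain r y x.
Proof.
move=> xy; apply: (xy (chain r ^~ x)) => // u v ux uv.
by apply: chain_trans ux; apply: chain_step; rewrite metric_sym.
Qed.

Lemma chain_le r r' x y : r <= r' -> chain r x y -> chain r' x y.
Proof.
move=> rr xy; apply: xy => // u v xu uv; apply: chain_trans xu _.
by apply: chain_step; apply: lt_le_trans rr.
Qed.

Lemma chain_similarity c f r x y : 0 < c -> similarity c f ->
  chain r x y -> chain (c * r) (f x) (f y).
Proof.
move=> c0 [fd _] xy; apply: (xy (fun z => chain (c * r) (f x) (f z))) => // u v xu uv.
by apply: chain_trans xu _; apply: chain_step; rewrite fd ltr_pM2l.
Qed.

Lemma chain_similarityE c f r x y : 0 < c -> similarity c f ->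
  chain (c * r) (f x) (f y) <-> chain r x y.
Proof.
move=> c0 fc; split; last exact: chain_similarity.
have [g gc gK] := similarity_inv c0 fc.
have fK z : g (f z) = z.
  apply: (@mdist_positivity R X); apply/eqP.
  by rewrite -(mulrI_eq0 _ (mulfI (lt0r_neq0 c0))) -fc.1 gK mdistxx.
have c'0 : 0 < c^-1 by rewrite invr_gt0.
move=> /(chain_similarity c'0 gc); by rewrite !fK mulKf// gt_eqF.
Qed.

(** A bounded clopen set is compact, hence at a positive distance [e] from its
    complement, so that no chain of steps shorter than [e] leaves it. *)
Lemma bounded_clopen_chain S q (M : R) : proper_metric X ->
  isometrically_homogeneous X -> open S -> open (~` S) -> S q ->
  (forall x, S x -> d q x <= M) ->
  exists2 e : R, 0 < e & forall x y, chain e x y -> d x y <= M.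
Proof.
move=> prop hom oS oSC Sq SM.
have [e e0 eS] : exists2 e : R, 0 < e & forall x y, S x -> d x y < e -> S y.
  apply: contrapT => H.
  have /choice[uv uvH] (n : nat) : exists uv : X * X,
      [/\ S uv.1, d uv.1 uv.2 < n.+1%:R^-1 & ~ S uv.2].
    apply: contrapT => /forallNP H'; apply: H; exists n.+1%:R^-1 => // x y Sx xy.
    by apply: contrapT => Sy; apply: (H' (x, y)).
  have [|w uw] := prop (fst \o uv) q M; first by move=> n; apply: SM; have [] := uvH n.
  have near_w (e : R) : 0 < e -> exists n, d w (uv n).1 < e /\ d w (uv n).2 < e.
    move=> e0; have e2 : 0 < e / 2 by rewrite divr_gt0.
    have [n hn] := ltr_add_invr e2; rewrite add0r in hn.
    have [m nm hm] := uw _ n e2; exists m; have [_ h _] := uvH m.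
    have {}h : d (uv m).1 (uv m).2 < e / 2.
      apply: lt_trans h _; apply: le_lt_trans hn.
      by rewrite lef_pV2 ?posrE// ler_nat ltnS.
    have := metric_triangle w (uv m).1 (uv m).2.
    by rewrite metric_sym in hm; rewrite /= in hm; split; lra.
  have [Sw|Sw] := pselect (S w).
    have [e e0 H'] := (open_mdistP _).1 oS w Sw.
    by have [n [_ /H' ?]] := near_w e e0; have [] := uvH n.
  have [e e0 H'] := (open_mdistP _).1 oSC w Sw.
  by have [n [/H' h _]] := near_w e e0; have [/h] := uvH n.
exists e => // x y xy; have [s ss sx] := homogeneous_similarity hom x q.
have := chain_similarity ltr01 ss xy; rewrite mul1r sx => qs.
by rewrite -[d x y]mul1r -ss.1 sx; apply: SM; apply: qs => // u v; exact: eS.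
Qed.

End chains.

Section labels.
Set Implicit Arguments.
Unset Strict Implicit.
Context {R : realType} (X : metricType R).
Local Notation d := (@mdist R X).
Implicit Types (x y z q : X) (k : int).

Hypothesis X_proper : proper_metric X.
Hypothesis X_homogeneous : isometrically_homogeneous X.
Hypothesis X_unbounded : unbounded X.
Variables (lam e M : R) (dil : X -> X) (p : X).
Hypothesis lam_gt1 : 1 < lam.
Hypothesis dil_similarity : similarity lam dil.
Hypothesis e_gt0 : 0 < e.
Hypothesis chain_bounded : forall x y, chain e x y -> d x y <= M.

(** The classes of [scale k] play the role of the balls of radius [lam ^ k] of
    an ultrametric; a similarity of ratio [lam ^ j] shifts the scale by [j]. *)
Definition scale k := chain (e * lam ^ k) : X -> X -> Prop.

Let lam_gt0 : 0 < lam. Proof. exact: lt_trans lam_gt1. Qed.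

Let lamk_gt0 k : 0 < lam ^ k. Proof. exact: exprz_gt0. Qed.

Lemma similarity_at k x : exists2 h, similarity (lam ^ k) h & h p = x.
Proof.
have [g gk] := similarity_exp k lam_gt0 dil_similarity.
have [s ss sx] := homogeneous_similarity X_homogeneous (g p) x.
by exists (s \o g) => //; rewrite -[lam ^ k]mul1r; exact: similarity_comp.
Qed.

Lemma scale_similarity k (j : int) h x y : similarity (lam ^ k) h ->
  scale (k + j) (h x) (h y) <-> scale j x y.
Proof.
move=> hk; rewrite /scale expfzDr ?gt_eqF// mulrCA.
exact: chain_similarityE (lamk_gt0 k) hk.
Qed.

Lemma scale_le k (j : int) x y : k <= j -> scale k x y -> scale j x y.
Proof. by move=> kj; apply: chain_le; rewrite ler_pM2l// ler_weXz2l// ltW. Qed.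

Lemma scale_bounded k x y : scale k x y -> d x y <= M * lam ^ k.
Proof.
have [h [hd hs] _] := similarity_at k p.
have [x' <-] := hs x; have [y' <-] := hs y.
rewrite -{1}[k]addr0 scale_similarity; last by split.
rewrite /scale expr0z mulr1 hd => /chain_bounded xy.
by rewrite mulrC ler_pM2r.
Qed.

(** If the greedy choice of pairwise unrelated points, starting from [p], never
    ended, it would give an [e]-separated bounded sequence. That [p] comes first
    is what gives it the label 1 in [labelling]. *)
Lemma finite_children : exists s : seq X,
  [/\ forall i, (i < size s)%N -> scale 1 p (nth p s i),
      forall i j, (i < j < size s)%N -> ~ scale 0 (nth p s i) (nth p s j),
      (0 < size s)%N, nth p s 0 = p
    & forall y, scale 1 p y -> exists2 i, (i < size s)%N & scale 0 (nth p s i) y].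
Proof.
pose good s := (forall i, (i < size s)%N -> scale 1 p (nth p s i)) /\
  (forall i j, (i < j < size s)%N -> ~ scale 0 (nth p s i) (nth p s j)).
pose new s y := scale 1 p y /\ forall i, (i < size s)%N -> ~ scale 0 (nth p s i) y.
apply: contrapT => none.
have /choice[nxt nxtP] s : exists y, good (p :: s) -> new (p :: s) y.
  apply: contrapT => /forallNP no; apply: none; exists (p :: s).
  have [gs _] := (not_implyP _ _).1 (no p).
  split => //; [exact: gs.1|exact: gs.2|].
  move=> y py; apply: contrapT => h; apply: (no y) => _; split => // i ip siy.
  by apply: h; exists i.
(* p is kept apart, in front of the points chosen so far *)
pose L n := iter n (fun s => rcons s (nxt s)) [::].
have LS n : L n.+1 = rcons (L n) (nxt (L n)) by [].
have sL n : size (L n) = n by elim: n => // n IH; rewrite LS size_rcons IH.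
have gL n : good (p :: L n).
  elim: n => [|n IH].
    split=> [[|i]//= _|[|i] [|j]//= /andP[]//]; exact: chain_refl.
  have [nS n0] := nxtP _ IH; rewrite LS -rcons_cons; split=> [i|i j].
    rewrite size_rcons ltnS leq_eqVlt nth_rcons => /orP[/eqP ->|ii].
      by rewrite ltnn eqxx.
    by rewrite ii; exact: IH.1.
  rewrite size_rcons ltnS => /andP[ij]; rewrite leq_eqVlt !nth_rcons => /orP[/eqP ej|jj].
    by subst j; rewrite ij ltnn eqxx; exact: n0.
  by rewrite jj (ltn_trans ij jj); apply: IH.2; rewrite ij.
pose u n := nth p (p :: L n) n.
have uE n i : (i <= n)%N -> nth p (p :: L n) i = u i.
  move=> /subnK <-; elim: (n - i)%N => // m IH.
  by rewrite addSn LS -rcons_cons nth_rcons /= sL ltnS leq_addl.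
have [|q uq] := @X_proper u p (M * lam ^ 1).
  by move=> n; apply: scale_bounded; apply: (gL n).1; rewrite /= sL.
have e2 : 0 < e / 2 by rewrite divr_gt0.
have [m _ hm] := uq _ 0%N e2; have [n mn hn] := uq _ m.+1 e2.
apply: ((gL n).2 m n); first by rewrite mn /= sL ltnS leqnn.
rewrite uE ?(ltnW mn)//; apply: chain_step; rewrite expr0z mulr1.
have := metric_triangle (u m) q (u n); rewrite (metric_sym q) -/(u n); lra.
Qed.

(** If the class of [p] did not split at scale 0, similarities would give the same
    at all scales, and the space would be the class of [p] of scale 0. *)
Lemma scale_split : exists2 y, scale 1 p y & ~ scale 0 p y.
Proof.
apply: contrapT => H.
have {}H y : scale 1 p y -> scale 0 p y.
  by move=> y1; apply: contrapT => y0; apply: H; exists y.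
have collapse k y : scale (k + 1) p y -> scale k p y.
  have [h hk hp] := similarity_at k p; have [y' <-] := hk.2 y.
  by rewrite -{1 2}hp -{2}[k]addr0 !scale_similarity//; exact: H.
have {collapse} all0 (n : nat) y : scale n%:Z p y -> scale 0 p y.
  by elim: n => // n IH; rewrite -addn1 PoszD => /collapse /IH.
have [y My] := unbounded_far X_unbounded p M.
suff [n pn] : exists n : nat, scale n%:Z p y.
  by have /all0/scale_bounded := pn; rewrite expr0z mulr1 leNgt My.
have [n hn] := exp_exceeds (d p y) lam_gt1 e_gt0.
by exists n; apply: chain_step.
Qed.

(** Each class of scale [k + 1] is the image of the class of scale 1 of [p] under
    a similarity [g]; the label of [x] at scale [k] is the rank, counted from 1, of
    the representative whose image under [g] is in the class of [x] of scale [k].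
    The similarity is chosen through a representative of the class of scale
    [k + 1], which is [p] itself for the class of [p]: this normalises the labels
    of [p] to 1. *)
Lemma labelling : exists (N : nat) (l : int -> X -> nat),
  [/\ (2 <= N)%N /\ (forall k x, (1 <= l k x <= N)%N),
      forall k x y, scale k x y -> l k x = l k y,
      forall k x y, scale (k + 1) x y -> l k x = l k y -> scale k x y,
      forall k x i, (1 <= i <= N)%N -> exists2 y, scale (k + 1) x y & l k y = i
    & forall k, l k p = 1%N].
Proof.
have [s [s1 s0 sgt0 sp sall]] := finite_children.
have s_inj i j : (i < size s)%N -> (j < size s)%N ->
    scale 0 (nth p s i) (nth p s j) -> i = j.
  move=> ii jj ij; apply: contrapT => /eqP; rewrite neq_ltn => /orP[h|h].
    by apply: (s0 i j) => //; rewrite h.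
  by apply: (s0 j i); [rewrite h|exact: chain_sym].
have [rep [repP rep_eq rep_p]] : exists rep : int -> X -> X,
    [/\ forall k x, scale k (rep k x) x,
        forall k x y, scale k x y -> rep k x = rep k y & forall k, rep k p = p].
  exists (fun k x => if pselect (scale k p x) then p else xget p (scale k x)).
  split=> [k x|k x y xy|k].
  - case: pselect => //= _; apply: chain_sym.
    by apply: (@xgetPex _ p (scale k x)); exists x; exact: chain_refl.
  - case: pselect => px; case: pselect => py //=.
    + by exfalso; apply: py; apply: chain_trans px xy.
    + by exfalso; apply: px; apply: chain_trans py (chain_sym xy).
    + congr xget; apply/seteqP; split=> z; apply: chain_trans => //.
      exact: chain_sym.
  - by case: pselect => //= h; exfalso; apply: h.
have /choice[h hP] (kx : int * X) :
    exists h, similarity (lam ^ kx.1) h /\ h p = kx.2.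
  by have [h h1 h2] := similarity_at kx.1 kx.2; exists h.
pose g k x := h (k, rep (k + 1) x).
have gk k x : similarity (lam ^ k) (g k x) by have [] := hP (k, rep (k + 1) x).
have gp k x : g k x p = rep (k + 1) x by have [] := hP (k, rep (k + 1) x).
have g_eq k x y : scale (k + 1) x y -> g k x = g k y.
  by move=> xy; rewrite /g (rep_eq _ _ _ xy).
have up k x y : scale k x y -> scale (k + 1) x y.
  by apply: scale_le; rewrite lerDl.
have g0 k x y z : scale k (g k x y) (g k x z) <-> scale 0 y z.
  by rewrite -{1}[k]addr0; exact: scale_similarity.
have g1 k x i : (i < size s)%N -> scale (k + 1) x (g k x (nth p s i)).
  move=> ii; apply: chain_trans (chain_sym (repP (k + 1) x)) _.
  by rewrite -gp; apply/(scale_similarity _ _ _ (gk k x)); exact: s1.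
have /choice[idx idxP] (kx : int * X) : exists i, (i < size s)%N /\
    scale kx.1 (g kx.1 kx.2 (nth p s i)) kx.2.
  case: kx => k x /=; have [w wx] := (gk k x).2 x.
  have : scale (k + 1) (g k x p) (g k x w) by rewrite gp wx; exact: repP.
  move=> /(scale_similarity _ _ _ (gk k x))/sall[i ii iw].
  by exists i; split => //; rewrite -[X in scale _ _ X]wx g0.
have idx_uniq k x i : (i < size s)%N -> scale k (g k x (nth p s i)) x ->
    idx (k, x) = i.
  move=> ii ix; have [/= jj jx] := idxP (k, x); apply: s_inj => //.
  by apply/(g0 k x); apply: chain_trans jx (chain_sym ix).
exists (size s), (fun k x => (idx (k, x)).+1); split.
- split; last by move=> k x; have [] := idxP (k, x).
  rewrite ltnNge; apply/negP => sle.
  have [y y1 y0] := scale_split; have [i ii iy] := sall y y1.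
  have i0 : i = 0%N by case: i ii {iy} => // i ii; have := leq_trans ii sle.
  by apply: y0; rewrite -sp -i0.
- move=> k x y xy; congr _.+1; have [/= ii iy] := idxP (k, y).
  apply: idx_uniq => //; rewrite (g_eq _ _ _ (up _ _ _ xy)).
  exact: chain_trans iy (chain_sym xy).
- move=> k x y xy [ixy]; have [/= _ ix] := idxP (k, x).
  have [/= _ iy] := idxP (k, y); rewrite -ixy -(g_eq _ _ _ xy) in iy.
  exact: chain_trans (chain_sym ix) iy.
- move=> k x [//|i] /= ii; exists (g k x (nth p s i)).
    exact: g1.
  congr _.+1; apply: idx_uniq => //.
  by rewrite -(g_eq _ _ _ (g1 k x i ii)).
- move=> k; congr _.+1; apply: idx_uniq => //.
  by rewrite sp gp rep_p.
Qed.

End labels.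

(** * Coding by sequences of labels *)

Section coding.
Set Implicit Arguments.
Unset Strict Implicit.
Context {R : realType} (X : metricType R).
Local Notation d := (@mdist R X).
Implicit Types (x y z q : X) (k : int).

Lemma bilipschitz_bij_homeomorphism (Y : metricType R) (f : X -> Y) :
  bilipschitz f -> (forall y : Y, exists x, f x = y) -> homeomorphism f.
Proof.
move=> [L [L1 fL]] fs; have L0 : 0 < L by apply: lt_le_trans L1.
have fcont : continuous f.
  move=> x; apply/metricType_numDomainType.cvgrPdist_lt => e e0.
  apply/(metricType_numDomainType.nbhs_mdistP x); exists (e / L); first by rewrite /= divr_gt0.
  move=> y /= xy; apply: le_lt_trans (fL x y).2 _.
  by rewrite mulrC -ltr_pdivlMr.
have finj x y : f x = f y -> x = y.
  move=> fxy; apply: mdist_positivity; apply/eqP; rewrite eq_le mdist_ge0 andbT.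
  by have [+ _] := fL x y; rewrite fxy mdistxx pmulr_rle0// invr_gt0.
split=> //; have [g gK] := choice fs; exists g; split => // [y|x]; last exact: finj.
apply/metricType_numDomainType.cvgrPdist_lt => e e0.
apply/(metricType_numDomainType.nbhs_mdistP y); exists (e / L); first by rewrite /= divr_gt0.
move=> z' /= yz; have [+ _] := fL (g y) (g z'); rewrite !gK => h.
rewrite ltr_pdivlMr// in yz; apply: le_lt_trans yz.
by rewrite mulrC -ler_pdivrMl.
Qed.

Lemma rho_agree_max (s : R) (xi zeta : int -> nat) m : 1 < s ->
  (forall i, agree_upto xi zeta i <-> i <= m) -> rho s xi zeta = s ^ (- m).
Proof.
move=> s1 H; rewrite /rho; have -> : agreement R xi zeta = (m%:~R)%:E.
  apply/eqP; rewrite eq_le; apply/andP; split.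
    by apply: ge_ereal_sup => _ [i /H im <-]; rewrite lee_fin ler_int.
  by apply: ereal_sup_ubound; exists m => //; apply/H.
by rewrite -mulrNz powR_intmul// ltW// (lt_trans ltr01).
Qed.

(** From here on, a family of nested partitions, comparable with the balls of
    radius [lam ^ k], and whose classes of scale [k] are numbered from 1 to [N]
    inside each class of scale [k + 1]. *)
Hypothesis X_proper : proper_metric X.
Variables (lam e M : R) (p : X) (N : nat).
Variables (E : int -> X -> X -> Prop) (l : int -> X -> nat).
Hypothesis lam_gt1 : 1 < lam.
Hypothesis e_gt0 : 0 < e.
Hypothesis E_sym : forall k x y, E k x y -> E k y x.
Hypothesis E_trans : forall k y x z, E k x y -> E k y z -> E k x z.
Hypothesis E_le : forall k j x y, k <= j -> E k x y -> E j x y.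
Hypothesis E_near : forall k x y, d x y < e * lam ^ k -> E k x y.
Hypothesis E_bounded : forall k x y, E k x y -> d x y <= M * lam ^ k.
Hypothesis l_range : forall k x, (1 <= l k x <= N)%N.
Hypothesis l_eq : forall k x y, E k x y -> l k x = l k y.
Hypothesis l_inj : forall k x y, E (k + 1) x y -> l k x = l k y -> E k x y.
Hypothesis l_surj : forall k x i, (1 <= i <= N)%N ->
  exists2 y, E (k + 1) x y & l k y = i.
Hypothesis l_p : forall k, l k p = 1%N.

Let lam_gt0 : 0 < lam. Proof. exact: lt_trans lam_gt1. Qed.

Let lamk_gt0 k : 0 < lam ^ k. Proof. exact: exprz_gt0. Qed.

Lemma E_large x y : exists n : nat, E n%:Z x y.
Proof.
have [n hn] := exp_exceeds (d x y) lam_gt1 e_gt0.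
by exists n; apply: E_near.
Qed.

Lemma E_small x y : x != y -> exists n : nat, ~ E (- n%:Z) x y.
Proof.
rewrite -mdist_gt0 => xy; have [n hn] := exp_exceeds M lam_gt1 xy.
exists n => /E_bounded; rewrite -exprnN ler_pdivlMr ?exprn_gt0//.
by rewrite leNgt hn.
Qed.

(** Large indices of a sequence are small scales of the space. *)
Definition code x : int -> nat := fun i => l (- i) x.

(** All points share a class at large scales, and from there on equal labels mean
    equal classes, going down one scale at a time. *)
Lemma code_agree x y m : agree_upto (code x) (code y) m <-> E (- m) x y.
Proof.
split=> [xy|xy i im]; last by apply: l_eq; apply: E_le xy; rewrite lerN2.
have [n xyn] := E_large x y.
have {xyn} : E (`|(n%:Z + m)%R|%N%:Z - m) x y.
  by apply: E_le xyn; lia.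
elim: `|_|%N => [|k IH]; first by rewrite sub0r.
rewrite -addn1 PoszD addrAC => /l_inj h; apply/IH/h.
by have := xy (m - k%:Z); rewrite /code opprB; apply; lia.
Qed.

Lemma code_boundary x : boundary_seq N (code x).
Proof.
split=> [i|]; first exact: l_range.
have [n xp] := E_large x p; exists (- n%:Z) => i im.
by rewrite /code -[RHS](l_p (- i)); apply: l_eq; apply: E_le xp; lia.
Qed.

(** Starting from [p], whose labels are all 1, correct the labels one scale after
    the other; an adherent value of the points so obtained has the wanted code. *)
Lemma code_surj xi : boundary_seq N xi -> exists x, code x = xi.
Proof.
move=> [xiN [m xim]].
have /choice[nxt nxtP] (nx : nat * X) : exists y,
    E (- (m + nx.1%:Z)) nx.2 y /\ l (- (m + nx.1.+1%:Z)) y = xi (m + nx.1.+1%:Z).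
  have [y h1 h2] := @l_surj (- (m + nx.1.+1%:Z)) nx.2 _ (xiN (m + nx.1.+1%:Z)).
  exists y; split => //; move: h1; congr (E _ _ _); lia.
pose u := fix u n := if n is n'.+1 then nxt (n', u n') else p.
have uS n : E (- (m + n%:Z)) (u n) (u n.+1) by have [] := nxtP (n, u n).
have ul n : l (- (m + n.+1%:Z)) (u n.+1) = xi (m + n.+1%:Z).
  by have [] := nxtP (n, u n).
have E_refl k x : E k x x by apply: E_near; rewrite mdistxx mulr_gt0.
have uE n j : E (- (m + n%:Z)) (u n) (u (j + n)%N).
  elim: j => // j IH; rewrite addSn; apply: E_trans IH _.
  by apply: E_le (uS _); lia.
have code_u n i : i <= m + n%:Z -> code (u n) i = xi i.
  elim: n i => [|n IH] i im; first by rewrite /code l_p xim//; lia.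
  have [<-|ne] := eqVneq (m + n.+1%:Z) i; first exact: ul.
  rewrite -IH; last by lia.
  by apply: l_eq; apply: E_sym; apply: E_le (uS n); lia.
have [|q uq] := @X_proper u p (M * lam ^ (- m)).
  move=> n; apply: E_bounded; have := uE 0%N n; rewrite addr0 addn0.
  exact.
exists q; apply/funext => i.
pose n := `|(i - m)%R|%N.
have [|j nj jq] := uq (e * lam ^ (- (m + n%:Z))) n; first by rewrite mulr_gt0.
rewrite -(code_u n) ?/n; last by lia.
apply: l_eq; apply: E_sym; apply: (@E_le (- (m + n%:Z))); first by rewrite /n; lia.
by have := uE n (j - n)%N; rewrite subnK// => /E_trans; apply; exact: E_near.
Qed.

Lemma code_max_scale x y : x != y -> exists m, forall i, E (- i) x y <-> i <= m.
Proof.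
move=> /E_small[n nE]; have [a aE] := E_large x y.
pose P (k : nat) := `[< E (k%:Z - n%:Z) x y >].
have exP : exists k : nat, P k.
  by exists (n + a)%N; apply/asboolP; apply: E_le aE; lia.
case: (ex_minnP exP) => k /asboolP kE kmin; exists (n%:Z - k%:Z) => i; split.
  move=> iE; rewrite leNgt; apply/negP => ki.
  have [h|h] := leP n%:Z i; first by apply: nE; apply: E_le iE; lia.
  have /kmin : P `|(n%:Z - i)%R|%N by apply/asboolP; apply: E_le iE; lia.
  lia.
by move=> im; apply: E_le kE; lia.
Qed.

(** The smallest scale [- m] at which [x] and [y] share a class gives both
    [d x y <= M * lam ^ (- m)] and [e * lam ^ (- m - 1) <= d x y], while the codes
    are at distance [lam ^ (- m)]. *)
Lemma coding_bilipschitz :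
  bilipschitz_homeomorphic X (tree_boundary N lam_gt1).
Proof.
have inC x : code x \in boundary_seq N by rewrite inE; exact: code_boundary.
pose f x : tree_boundary N lam_gt1 := SigSub (inC x).
have fE x : set_val (f x) = code x by [].
exists f.
suff fL : bilipschitz f.
  split => //; apply: bilipschitz_bij_homeomorphism => // xi.
  have [x xxi] := code_surj (boundary_seqP xi); exists x.
  by apply: val_inj; exact: xxi.
exists (Num.max 1 (Num.max M (lam / e))).
set L := Num.max _ _.
have L1 : 1 <= L by rewrite le_max lexx.
have LM : M <= L by rewrite !le_max lexx !orbT.
have Le : lam / e <= L by rewrite !le_max lexx !orbT.
have L0 : 0 < L by apply: lt_le_trans L1.
split => // x y; have [->|xy] := eqVneq x y; first by rewrite !mdistxx !mulr0.
have [m mE] := code_max_scale xy.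
have -> : mdist (f x) (f y) = lam ^ (- m).
  by apply: rho_agree_max => // i; rewrite !fE code_agree.
split.
  rewrite mulrC ler_pdivrMr//; have /E_bounded h := (mE m).2 (lexx m).
  by rewrite mulrC (le_trans h)// ler_wpM2r// ltW.
have : ~ d x y < e * lam ^ (- (m + 1)) by move=> /E_near/mE; lia.
move=> /negP; rewrite -leNgt => h; apply: le_trans (ler_wpM2r (mdist_ge0 x y) Le).
rewrite -mulrA -ler_pdivrMl// mulrC ler_pdivlMl//.
apply: le_trans h; rewrite opprD expfzDr ?gt_eqF// -[lam ^ (-1)]/(lam^-1).
Qed.

End coding.

Theorem theorem1p11 (R : realType) (X : metricType R) :
  ~ connected [set: X] ->
  unbounded X ->
  locally_compact [set: X] ->
  isometrically_homogeneous X ->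
  invertible X ->
  exists (N : nat) (s : R) (s1 : 1 < s),
    (2 <= N)%N /\ bilipschitz_homeomorphic X (tree_boundary N s1).
Proof.
move=> disc ub lc hom inv.
have [p [T Tinv]] := invertible_inversion inv.
have [r r0 rcpt] := homogeneous_uniform_compact p lc hom.
have Tr x : x != p -> mdist (T x) p = (mdist x p)^-1.
  exact: (inversion_mdist ub r0 rcpt Tinv).
have Xproper := inversion_proper ub r0 rcpt hom Tinv.
have [lam lam1 [dil dilP]] := dilation_exists ub hom Tinv Tr.
have [A [oA oAC A0 AC0]] := disconnected_clopen disc.
have [S [q [M [oS oSC Sq SM]]]] := bounded_clopen Xproper hom Tinv Tr oA oAC A0 AC0.
have [e e0 eM] := bounded_clopen_chain Xproper hom oS oSC Sq SM.
have [N [l [[N2 lN] l_eq l_inj l_surj l_p]]] :=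
  labelling Xproper hom ub p lam1 dilP e0 eM.
exists N, lam, lam1; split => //.
apply: (coding_bilipschitz Xproper (M := M) (E := scale lam e) lam1 e0 _ _ _ _ _ lN l_eq l_inj l_surj l_p).
- by move=> k x y; exact: chain_sym.
- by move=> k y x z; exact: chain_trans.
- by move=> k j x y; exact: (scale_le lam1 e0).
- by move=> k x y; exact: chain_step.
- by move=> k x y; exact: (scale_bounded hom p lam1 dilP eM).
Qed.
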